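(* A number $N$ is an even perfect number if and only if $N=2^{p-1}(2^p-1)$ for some prime $p$, and $$2n-1\ \Big|\ \frac{\Omega_0\big(\lfloor n/2\rfloor\,|\,1,4\,|\,n\big)}{(n-1)(n-2)\cdots(n-\lfloor n/2\rfloor)},$$ where $n:=2^{p-1}$.
   Context: For an integer $m\ge 0$, $\delta(m)\in\{0,1\}$ is the residue of $m$ modulo $2$. For a natural number $n$ and a point $(\zeta,\xi)\ne(0,0)$, the Omega sequence $\Omega_r(k|\zeta,\xi|n)$, for integers $r,k\ge 0$ with $r+k\le\lfloor n/2\rfloor$, is defined by $\Omega_r(0|\zeta,\xi|n)=1$ for all $r$ and, for $k\ge 1$, $$\Omega_r(k|\zeta,\xi|n)=(2\zeta-\xi)(n-r-k)\,\Omega_r(k-1|\zeta,\xi|n)-2\zeta\,(n-2r-\delta(n-1))\,\Omega_{r+1}(k-1|\zeta,\xi|n).$$ The ratio in the claim is an integer, and divisibility is in the integers. A positive integer is perfect if it equals the sum of its proper positive divisors.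
   Formalization: The number N = 6 is excluded: it is an even perfect number (p = 2, n = 2), but the ratio is then -4, which is not divisible by 2n-1 = 3, so the stated equivalence fails there; for all other N it is proved as stated. *)

(* Defs.v *)
From mathcomp Require Import all_boot all_order all_algebra.

Set Implicit Arguments.
Unset Strict Implicit.
Unset Printing Implicit Defensive.

Import GRing.Theory.
Local Open Scope ring_scope.

Definition delta (m : nat) : nat := (m %% 2)%N.

(* [Omega zeta xi n r k] is Omega_r(k | zeta, xi | n).  It is total in [r] and
   [k]; the recursion preserves or decreases [r + k], so on the intended range
   [r + k <= n./2] it involves only values in that range.  The subtractions
   [n - r - k] and [n - 2r - delta (n - 1)] are taken in the ring, not truncated
   in [nat]; only the argument [n - 1] of [delta] is in [nat] (so [n >= 1]). *)
Fixpoint Omega (R : comNzRingType) (zeta xi : R) (n r k : nat) {struct k} : R :=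
  match k with
  | 0%N => 1
  | k'.+1 =>
      (2 * zeta - xi) * (n%:R - r%:R - k%:R) * Omega zeta xi n r k'
      - 2 * zeta * (n%:R - 2 * r%:R - (delta (n - 1)%N)%:R)
        * Omega zeta xi n r.+1 k'
  end.

Definition perfect (N : nat) : Prop :=
  (0 < N)%N /\ (\sum_(d <- divisors N | (d < N)%N) d)%N = N.

(* The quotient is formed in [rat], so that its integrality is not presupposed
   by the use of a Euclidean division. *)
Definition Omega_ratio (n : nat) : rat :=
  (Omega (1 : int) 4 n 0 n./2)%:~R / \prod_(1 <= j < (n./2).+1) (n%:R - j%:R).

Definition int_dvd_rat (d : int) (q : rat) : Prop :=
  exists2 z : int, q = z%:~R & (d %| z)%Z.

(* Main.v *)
Require Import Defs.
From mathcomp Require Import all_boot all_order all_algebra all_field.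
From mathcomp Require Import zify ring.

Set Implicit Arguments.
Unset Strict Implicit.
Unset Printing Implicit Defensive.

(** The theorem is the Euclid-Euler description of the even perfect numbers, in
    which the primality of the Mersenne number [2 ^ p - 1] is tested by the
    Lucas-Lehmer criterion, written with the Omega sequence.

    The link is the identity [Omega_half]: for [n = m.*2], the last entry
    [Omega z x n 0 m] is [(n - 1) * ... * (n - m)] times the Lucas number
    [V_m(-x, z^2)].  Unfolding the recursion gives a closed form as a binomial
    sum ([Omega_even_sum]), because the weights met do not depend on the order in
    which its two summands are chosen.  For these parameters its coefficients
    are, up to the common factor, those of Waring's formula
    [x^n + y^n = sum_i n / (n - i) * C(n - i, i) * (x + y)^(n - 2 i) * (- x y)^i]
    ([omega_coefE]), and these sum to Lucas numbers ([waring_sum_lucasV]).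

    For [z = 1], [x = 4] and [n = 2 ^ p.-1] the ratio is therefore
    [V_m(-4, 1) = w ^ m + w' ^ m] with [m = 2 ^ (p - 2)] and [w], [w'] the numbers
    [-2 + sqrt 3] and [-2 - sqrt 3], whose product is 1: the usual Lucas-Lehmer
    residue.  It is divisible by a prime [q] if and only if
    [w ^ (2 ^ p.-1) = -1] in a ring of characteristic [q] with a square root of 3
    ([lucasV_eq0]).  If [2 ^ p - 1] divides it without being prime, [w] has too
    large an order for the [q ^ 2] elements of [F_q[sqrt 3]], [q] being a prime
    divisor with [q ^ 2 <= 2 ^ p - 1] ([lucas_lehmer_sufficient]).  If
    [q = 2 ^ p - 1] is prime, the Frobenius map computes [w ^ (2 ^ p.-1)], since
    2 is a square modulo [q] and 3 is not ([lucas_lehmer_necessary]). *)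

(** * Even perfect numbers and Mersenne primes *)

Definition sigma (n : nat) : nat := \sum_(d <- divisors n) d.

Lemma perfectE n : 0 < n -> perfect n <-> sigma n = 2 * n.
Proof.
move=> n_gt0; rewrite /perfect /sigma.
have -> : \sum_(d <- divisors n) d = n + \sum_(d <- divisors n | d < n) d.
  rewrite (bigD1_seq n) ?divisors_uniq ?divisors_id //=; congr (_ + _).
  rewrite big_seq_cond [RHS]big_seq_cond; apply: eq_bigl => d.
  case: (boolP (d \in divisors n)) => //=; rewrite -dvdn_divisors // => dn.
  by rewrite ltn_neqAle (dvdn_leq n_gt0 dn) andbT.
by split; [case | split=> //]; lia.
Qed.

Lemma sigma_prime q : prime q -> sigma q = q.+1.
Proof.
move=> q_pr; rewrite /sigma.
have q_gt0 := prime_gt0 q_pr.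
rewrite (perm_big [:: 1; q]) ?big_cons ?big_nil /= ?addn0 //.
apply: uniq_perm; rewrite ?divisors_uniq //=.
  by rewrite inE andbT; have := prime_gt1 q_pr; case: eqP => //; lia.
move=> d; rewrite -dvdn_divisors // !inE.
apply/idP/orP => [dq | [/eqP-> | /eqP-> ]]; rewrite ?dvd1n //.
by have /primeP[_ /(_ d dq)/orP] := q_pr.
Qed.

(** Used with lists of two or three divisors: it turns an upper bound on
    [sigma n] into the absence of further divisors. *)
Lemma leq_sigma_sub n (s : seq nat) :
  0 < n -> uniq s -> {in s, forall d, d %| n} -> \sum_(d <- s) d <= sigma n.
Proof.
move=> n_gt0 s_uniq s_dvd; rewrite /sigma.
rewrite [leqRHS](perm_big (s ++ [seq d <- divisors n | d \notin s])).
  by rewrite big_cat leq_addr.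
apply: uniq_perm; rewrite ?divisors_uniq // ?cat_uniq ?s_uniq ?filter_uniq
  ?divisors_uniq ?andbT //.
  by apply/hasPn => d; rewrite mem_filter => /andP[].
move=> d; rewrite mem_cat mem_filter -dvdn_divisors //.
by case: (boolP (d \in s)) => [/s_dvd | ].
Qed.

(** The odd divisors of [2 ^ k.+1 * m] are the divisors of [m], and the even
    ones are the doubles of the divisors of [2 ^ k * m]. *)
Lemma sigma_pow2_rec k m :
  odd m -> sigma (2 ^ k.+1 * m) = sigma m + 2 * sigma (2 ^ k * m).
Proof.
move=> m_odd; have m_gt0 : 0 < m by case: m m_odd.
rewrite /sigma (perm_big (divisors m ++ [seq 2 * d | d <- divisors (2 ^ k * m)])).
  by rewrite big_cat big_map big_distrr.
apply: uniq_perm; first exact: divisors_uniq.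
  rewrite cat_uniq divisors_uniq map_inj_uniq ?divisors_uniq; last by move=> x y; lia.
  rewrite andbT; apply/hasPn => _ /mapP[d _ ->]; rewrite -dvdn_divisors //.
  by apply/negP => /(dvdn_odd)/(_ m_odd); rewrite oddM.
move=> d; rewrite mem_cat -!dvdn_divisors ?muln_gt0 ?expn_gt0 //.
have [d_odd | d_even] := boolP (odd d).
  rewrite Gauss_dvdr ?coprime_pexpr ?coprimen2 //.
  by case: (d %| m) => //=; apply/esym/negP => /mapP[e _ de];
    move: d_odd; rewrite de oddM.
have /negPf-> : ~~ (d %| m) by apply: contra d_even => /dvdn_odd; apply.
have -> : d = 2 * d./2 by lia.
rewrite mem_map /= => [|x y]; last lia.
by rewrite -dvdn_divisors ?muln_gt0 ?expn_gt0 ?m_gt0 // expnS -mulnA dvdn_pmul2l.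
Qed.

Lemma sigma_pow2M k m :
  odd m -> sigma (2 ^ k * m) = (2 ^ k.+1 - 1) * sigma m.
Proof.
move=> m_odd; elim: k => [|k IHk]; first by rewrite !mul1n.
rewrite sigma_pow2_rec // IHk mulnA -mulSn; congr (_ * _).
by rewrite mulnBr -expnS; have := expn_gt0 2 k.+2; rewrite [2 ^ k.+2]expnS; lia.
Qed.

(** The Euclid-Euler theorem.  Euler's half: write [n = 2 ^ k * m] with [m]
    odd and [M = 2 ^ k.+1 - 1]; perfection reads [M * sigma m = M.+1 * m], so
    [m = c * M] and [sigma m = m + c].  As [c] and [m] are already two divisors
    of [m] with that sum, there is no third one, which forces [c = 1] and [m]
    prime. *)
Lemma even_perfectP n :
  perfect n /\ ~~ odd n <->
  exists p, [/\ 1 < p, n = 2 ^ p.-1 * (2 ^ p - 1) & prime (2 ^ p - 1)].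
Proof.
split=> [[n_perf n_even] | [[|[|k]] [// _ -> q_pr]]]; last first.
  have q_odd : odd (2 ^ k.+2 - 1) by rewrite oddB ?expn_gt0 // oddX.
  split; last by rewrite /= oddM oddX.
  have n_gt0 : 0 < 2 ^ k.+2.-1 * (2 ^ k.+2 - 1).
    by rewrite muln_gt0 expn_gt0 (prime_gt0 q_pr).
  apply/(perfectE n_gt0).
  rewrite sigma_pow2M // (sigma_prime q_pr) /= subn1 prednK ?expn_gt0 //.
  by rewrite (expnS 2 k.+1) mulnC mulnA.
have n_gt0 : 0 < n by case: n_perf.
move/(perfectE n_gt0): n_perf => sigma_n.
have [m] := pfactor_coprime (isT : prime 2) n_gt0.
rewrite coprime2n; move: (logn 2 n) => k m_odd n_eq.
have m_gt0 : 0 < m by case: m m_odd {n_eq}.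
have k_gt0 : 0 < k by case: k n_eq n_even => // ->; rewrite muln1 m_odd.
move: sigma_n; rewrite n_eq mulnC sigma_pow2M // mulnA -expnS.
set M := 2 ^ k.+1 - 1 => sigma_m.
have M_eq : 2 ^ k.+1 = M.+1 by have := expn_gt0 2 k.+1; rewrite /M; lia.
have M_gt2 : 2 < M.
  by have := leq_pexp2l (isT : 0 < 2) k_gt0; rewrite expn1 /M expnS; move: (2 ^ k); lia.
have M_def : 2 ^ k.+1 - 1 = M by [].
clearbody M.
have [c m_eq] : exists c, m = c * M.
  apply/dvdnP; rewrite -(@Gauss_dvdr M (2 ^ k.+1)) ?M_eq ?coprimenS //.
  by rewrite -M_eq -sigma_m dvdn_mulr.
have c_gt0 : 0 < c by case: c m_eq m_gt0 => // ->.
have sigma_mE : sigma m = m + c.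
  by apply/eqP; rewrite -(eqn_pmul2l (ltnW (ltnW M_gt2))) sigma_m M_eq; apply/eqP; lia.
have c_lt_m : c < m by rewrite m_eq -{1}(muln1 c) ltn_pmul2l // (ltnW M_gt2).
have c_eq1 : c = 1.
  apply/eqP; apply: contraT => c_neq1.
  have : \sum_(d <- [:: 1; c; m]) d <= sigma m.
    apply: leq_sigma_sub => //=.
      by rewrite !inE negb_or; do !(apply/andP; split); lia.
    move=> d; rewrite !inE => /or3P[] /eqP-> //.
    by rewrite m_eq dvdn_mulr.
  by rewrite !big_cons big_nil sigma_mE; lia.
have m_M : m = M by rewrite m_eq c_eq1 mul1n.
exists k.+1; rewrite M_def; split; first by [].
  by rewrite m_M.
apply/primeP; split=> [|d dM]; first by lia.
apply: contraT; rewrite negb_or => /andP[d_neq1 d_neqM].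
have : \sum_(x <- [:: 1; d; M]) x <= sigma M.
  apply: leq_sigma_sub => //=; first by lia.
    by rewrite !inE negb_or; do !(apply/andP; split); lia.
  by move=> x; rewrite !inE => /or3P[] /eqP->.
rewrite !big_cons big_nil -{2}m_M sigma_mE c_eq1.
have := dvdn_gt0 _ dM; lia.
Qed.

Lemma mersenne_prime_exponent p : prime (2 ^ p - 1) -> prime p.
Proof.
move=> M_pr.
have p_gt1 : 1 < p by case: p M_pr => [|[|p]].
apply/primeP; split=> // d /dvdnP[e p_eq].
have e_gt0 : 0 < e by lia.
have : 2 ^ d - 1 %| 2 ^ p - 1 by rewrite p_eq mulnC expnM !subn1 dvdn_pred_predX.
case/primeP: M_pr => _ M_div /M_div /orP[] /eqP.
  by case: d {p_eq M_div} => [|[|d]] //; have := expn_gt0 2 d; rewrite !expnS; lia.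
move=> M_eq; apply/orP; right; rewrite -(eqn_exp2l _ _ (isT : 1 < 2)).
by have := expn_gt0 2 d; have := expn_gt0 2 p; lia.
Qed.

(** * The Omega sequence and Lucas numbers *)

Section OmegaClosedForm.

Import GRing.Theory.
Local Open Scope ring_scope.

Variables (R : comNzRingType).
Implicit Types (z x a b : R).

(** The Lucas sequence of the second kind [V_k(P, Q)]. *)
Fixpoint lucasV (P Q : R) (k : nat) : R :=
  match k with
  | 0 => 2
  | 1 => P
  | (k''.+1 as k').+1 => P * lucasV P Q k' - Q * lucasV P Q k''
  end.

Lemma lucasVSS P Q k :
  lucasV P Q k.+2 = P * lucasV P Q k.+1 - Q * lucasV P Q k.
Proof. by []. Qed.

(** The coefficient [n / (n - i) * 'C(n - i, i)] in Waring's formula for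
    [x ^+ n + y ^+ n] in terms of [x + y] and [x * y].  It is defined by its
    Pascal rule, which avoids the division; the value 2 at (0, 0), that is
    [x ^+ 0 + y ^+ 0], is what makes the rule hold from [n = 0] on. *)
Fixpoint waring (n i : nat) : nat :=
  match n, i with
  | 0, 0 => 2
  | 0, _.+1 => 0
  | _.+1, 0 => 1
  | 1, _.+1 => 0
  | (n''.+1 as n').+1, i'.+1 => waring n' i + waring n'' i'
  end.

Arguments waring : simpl never.

Lemma waringSS n i :
  waring n.+2 i.+1 = (waring n.+1 i.+1 + waring n i)%N.
Proof. by []. Qed.

Lemma waringS0 n : waring n.+1 0 = 1%N.
Proof. by case: n. Qed.

Lemma waring_small n i : (n < i.*2)%N -> waring n i = 0%N.
Proof.
have [k] := ubnP n; elim: k n i => // k IHk [|[|n]] [|i] // nk ni.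
by rewrite waringSS !IHk; lia.
Qed.

Lemma waring_diag i : waring i.*2 i = 2%N.
Proof. by elim: i => // i IHi; rewrite doubleS waringSS waring_small ?IHi; lia. Qed.

(** This is [waring n i = n / (n - i) * 'C(n - i, i)] with denominators cleared;
    writing [n = i.*2 + d] keeps truncated subtractions out of the induction. *)
Lemma waring_fact i d : (0 < i + d)%N ->
  (waring (i.*2 + d) i * i`! * d`! = (i.*2 + d) * (i + d).-1`!)%N.
Proof.
have [k] := ubnP (i.*2 + d)%N; elim: k i d => // k IHk [|i] [|d] // lt_k _.
- by rewrite !add0n waringS0 !mul1n factS.
- by rewrite !addn0 waring_diag factS doubleS fact0 -muln2 /=; lia.
- have IH1 := IHk i.+1 d; have {IHk} IH2 := IHk i d.+1.
  rewrite (_ : i.+1.*2 + d.+1 = (i.*2 + d).+3)%N; last by lia.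
  rewrite waringSS.
  rewrite (_ : i.+1.*2 + d = (i.*2 + d).+2)%N in IH1; last by lia.
  rewrite (_ : i.*2 + d.+1 = (i.*2 + d).+1)%N in IH2; last by lia.
  move: IH1 IH2; rewrite (addnS i.+1 d) (addSn i d) (addnS i d) !succnK.
  rewrite !factS => IH1 IH2.
  have {}IH1 := IH1 ltac:(lia) isT; have {}IH2 := IH2 ltac:(lia) isT.
  move: IH1 IH2; move: (waring _ _) (waring _ _) (i`!) (d`!) ((i + d)`!).
  move=> W2 W1 a b c IH1 IH2.
  rewrite (_ : (W1 + W2) * (i.+1 * a) * (d.+1 * b)
    = d.+1 * (W1 * (i.+1 * a) * b) + i.+1 * (W2 * a * (d.+1 * b)))%N; last by nia.
  by rewrite IH1 IH2; nia.
Qed.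

(** The contribution to [Omega z x n r k] of the ways of unfolding the recursion
    in which the second summand is chosen [i] times.  A choice of the second
    summand raises [r] and lowers [k], hence leaves [r + k] unchanged, and a
    choice of the first lowers [r + k] by one; so the weights met are the same
    two products whatever the order of the choices, and there are [binomial k i]
    orders. *)
Definition omega_term (n r z x : R) (k i : nat) : R :=
  (2 * z - x) ^+ (k - i) * (- (2 * z)) ^+ i
  * \prod_(j < i) (n - 2 * r - 1 - 2 * j%:R)
  * \prod_(j < k - i) (n - r - k%:R + j%:R).

(** The closed form of the sequence; the proof is that of the binomial theorem,
    [Hstay] and [Hmove] saying how the two summands of the recursion act on a
    term. *)
Lemma Omega_even_sum z x n r k : (0 < n)%N -> ~~ odd n ->
  Omega z x n r k = \sum_(i < k.+1)  omega_term n%:R r%:R z x k i *+ 'C(k, i).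
Proof.
move=> n_gt0 n_even.
have dE : delta (n - 1) = 1%N by rewrite /delta; lia.
elim: k r => [|k IHk] r.
  by rewrite big_ord1 /omega_term !big_ord0 /= !mulr1.
rewrite /= dE !IHk.
have Hstay i : (i <= k)%N ->
   (2 * z - x) * (n%:R - r%:R - k.+1%:R) * omega_term n%:R r%:R z x k i
   = omega_term n%:R r%:R z x k.+1 i.
  move=> ik; rewrite /omega_term subSn // big_ord_recl /= exprS.
  rewrite [in RHS](eq_bigr (fun j : 'I_(k - i) => n%:R - r%:R - k%:R + j%:R)) => [|j _].
    by ring.
  by rewrite /bump leq0n add1n; ring.
have Hmove i :
   - (2 * z) * (n%:R - 2 * r%:R - 1) * omega_term n%:R r.+1%:R z x k i
   = omega_term n%:R r%:R z x k.+1 i.+1.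
  rewrite /omega_term subSS big_ord_recl /= exprS.
  rewrite [in RHS](eq_bigr (fun j : 'I_i => n%:R - 2 * r.+1%:R - 1 - 2 * j%:R)) => [|j _].
    rewrite [in RHS](eq_bigr (fun j : 'I_(k - i) => n%:R - r.+1%:R - k%:R + j%:R)) => [|j _].
      by ring.
    by ring.
  by rewrite /bump leq0n add1n; ring.
rewrite -[X in _ + X]mulNr -(mulNr (2 * z)) !big_distrr /=.
rewrite [RHS]big_ord_recl /= bin0 /bump /=.
rewrite [X in X + _]big_ord_recl /= bin0 mulr1n Hstay // -addrA; congr (_ + _).
under [RHS]eq_bigr => i _ do rewrite add1n binS mulrnDr.
rewrite big_split /=; congr (_ + _); last first.
  by apply: eq_bigr => i _; rewrite -Hmove; exact: mulrnAr.
rewrite [RHS]big_ord_recr /= bin_small // mulr0n addr0.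
by apply: eq_bigr => i _; rewrite /bump add1n -Hstay ?ltn_ord //; exact: mulrnAr.
Qed.

Lemma prod_addn_fact m d : (0 < m)%N ->
  (\prod_(j < d) (m + j) * (m.-1)`! = (m + d).-1`!)%N.
Proof.
move=> m_gt0; elim: d => [|d IHd]; first by rewrite big_ord0 addn0 mul1n.
rewrite big_ord_recr /= mulnAC IHd mulnC addnS /=.
by rewrite -{1 3}(@prednK (m + d)) ?factS //; lia.
Qed.

Lemma prod_subn_fact m : (0 < m)%N ->
  (\prod_(1 <= j < m.+1) (m.*2 - j) * (m.-1)`! = (m.*2.-1)`!)%N.
Proof.
move=> m_gt0; rewrite -addnn -prod_addn_fact //; congr (_ * _)%N.
rewrite big_add1 /= big_mkord [RHS](reindex_inj rev_ord_inj) /=.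
by apply: eq_bigr => j _; have := ltn_ord j; lia.
Qed.

Lemma prod_odd_fact i d :
  (\prod_(j < i) ((i + d).*2 - 1 - 2 * j) * 2 ^ i * (i + d)`! * d.*2`!
   = (i + d).*2`! * d`!)%N.
Proof.
elim: i => [|i IHi]; first by rewrite big_ord0 !mul1n mulnC.
rewrite big_ord_recl /= expnS addSn doubleS !factS.
rewrite (eq_bigr (fun j : 'I_i => (i + d).*2 - 1 - 2 * j)%N) => [|j _]; last first.
  by rewrite /bump /=; lia.
transitivity ((i + d).*2.+2 * ((i + d).*2.+1 *
  (\prod_(j < i) ((i + d).*2 - 1 - 2 * j) * 2 ^ i * (i + d)`! * d.*2`!)))%N; last first.
  by rewrite IHi; lia.
by move: (\prod_(j < i) _)%N (2 ^ i)%N => P e; lia.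
Qed.

(** For [n = m.*2], [r = 0] and [k = m], where [m = i + d], the integer
    coefficient of a term of the closed form, including the power of 2 that comes
    from [2 * z], is a Waring coefficient times a
    product that does not depend on [i]: the denominator of the ratio.  Both
    sides are quotients of factorials, so they are compared after multiplication
    by a common denominator. *)
Lemma omega_coefE i d : (0 < i + d)%N ->
  ('C(i + d, i) * \prod_(j < i) ((i + d).*2 - 1 - 2 * j) *
   \prod_(j < d) (i + d + j) * 2 ^ i
   = waring (i + d).*2 i * \prod_(1 <= j < (i + d).+1) ((i + d).*2 - j))%N.
Proof.
move=> m_gt0; apply/eqP.
have c_gt0 : (0 < i`! * d.*2`! * (i + d).-1`! * d`!)%N by rewrite !muln_gt0 !fact_gt0.
rewrite -(eqn_pmul2r c_gt0); apply/eqP.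
have E1 := bin_fact (leq_addr d i); rewrite addKn in E1.
have E2 := prod_odd_fact i d.
have E3 := prod_addn_fact d m_gt0.
have E4 := prod_subn_fact m_gt0.
have := @waring_fact i d.*2; rewrite -doubleD => /(_ ltac:(lia)) E5.
have E6 : ((i + d).*2`! = (i + d).*2 * (i + d).*2.-1`!)%N.
  by rewrite -{1}(@prednK (i + d).*2) ?factS ?prednK //; lia.
have E7 : (i + d + d).-1 = (i + d.*2).-1 by lia.
rewrite E7 in E3.
move: E1 E2 E3 E4 E5 E6.
move: (\prod_(j < i) _)%N (\prod_(j < d) _)%N (\prod_(1 <= j < _) _)%N 'C(i + d, i).
move: (waring _ _) => W P1 P2 P3 C.
move: (i`!) (d`!) (d.*2`!) ((i + d).-1`!) ((i + d)`!) ((i + d).*2`!).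
move: ((i + d).*2.-1`!) ((i + d.*2).-1`!) (2 ^ i)%N.
move=> h k t a b c e f g E1 E2 E3 E4 E5 E6.
transitivity ((P2 * e) * (P1 * t * (C * (a * b)) * c))%N; first by lia.
transitivity ((W * a * c) * (P3 * e) * b)%N; last by lia.
by rewrite E1 E2 E3 E4 E5 E6; lia.
Qed.

(** With [a = P ^+ 2], [b = - Q] and [e = n./2], this is [V_n(P, Q)] if [n] is
    even and [V_n(P, Q) / P] if [n] is odd.  The index [e] is separate from [n]
    so that the Pascal rule for [waring] carries over without distinguishing
    parities. *)
Definition waring_sum a b n e : R :=
  \sum_(i < e.+1) a ^+ (e - i) * b ^+ i *+ waring n i.

Lemma waring_sumSS a b n e :
  waring_sum a b n.+2 e.+1 = waring_sum a b n.+1 e.+1 + b * waring_sum a b n e.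
Proof.
rewrite /waring_sum big_ord_recl [X in _ = X + _]big_ord_recl !waringS0 -addrA; congr (_ + _).
rewrite big_distrr -big_split /=; apply: eq_bigr => i _.
by rewrite /bump add1n waringSS mulrnDr subSS exprS mulrCA mulrnAr.
Qed.

Lemma waring_sum_widen a b n e : (n < e.+1.*2)%N ->
  waring_sum a b n e.+1 = a * waring_sum a b n e.
Proof.
move=> n_lt; rewrite /waring_sum big_ord_recr /= waring_small // mulr0n addr0.
rewrite big_distrr; apply: eq_bigr => i _ /=.
by rewrite (subSn (leq_ord i)) exprS -mulrA mulrnAr.
Qed.

(** Two steps of the recursion in [n], from [m.*2] to [m.*2.+2], give the Lucas
    recursion in [m] with parameters [P ^+ 2 - 2 * Q] and [Q ^+ 2].  These involve
    only [P ^+ 2 = 2 * z - x] and [Q = z], and are [- x] and [z ^+ 2]. *)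
Lemma waring_sum_lucasV z x m :
  waring_sum (2 * z - x) (- z) m.*2 m = lucasV (- x) (z ^+ 2) m.
Proof.
set a := 2 * z - x; set b := - z.
pose D k := waring_sum a b k.*2 k; pose O k := waring_sum a b k.*2.+1 k.
have DS k : D k.+1 = a * O k + b * D k.
  by rewrite /D doubleS waring_sumSS waring_sum_widen //; lia.
have OS k : O k.+1 = D k.+1 + b * O k.
  by rewrite /O doubleS waring_sumSS /D doubleS.
have D0 : D 0 = 2 by rewrite /D /waring_sum big_ord1 /= mulr1.
have O0 : O 0 = 1 by rewrite /O /waring_sum big_ord1 /= mulr1.
suff : D m = lucasV (- x) (z ^+ 2) m /\ D m.+1 = lucasV (- x) (z ^+ 2) m.+1 by case.
elim: m => [|m [IH1 IH2]].
  by rewrite DS D0 O0 /= /a /b; split=> //; ring.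
split=> //; rewrite lucasVSS -IH1 -IH2 !DS OS DS /a /b; ring.
Qed.

(** By [omega_coefE] the denominator of the ratio is a common factor of the terms
    of the closed form, and what it leaves is a Waring sum. *)
Lemma Omega_half z x m : (0 < m)%N ->
  Omega z x m.*2 0 m
  = lucasV (- x) (z ^+ 2) m * \prod_(1 <= j < m.+1) (m.*2%:R - j%:R).
Proof.
move=> m_gt0; rewrite Omega_even_sum ?double_gt0 ?odd_double //.
rewrite -waring_sum_lucasV mulrC /waring_sum big_distrr /=; apply: eq_bigr => [[i]] /=.
rewrite ltnS => /subnKC; set d := (m - i)%N; move: d => d m_eq _.
subst m.
rewrite /omega_term addKn -mulrN exprMn.
have -> : \prod_(j < i) ((i + d).*2%:R - 2 * 0%:R - 1 - 2 * j%:R)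
   = (\prod_(j < i) ((i + d).*2 - 1 - 2 * j)%N)%:R :> R.
  rewrite natr_prod; apply: eq_bigr => j _.
  by rewrite !natrB ?natrM ?mulr0 ?subr0 //; have := ltn_ord j; lia.
have -> : \prod_(j < d) ((i + d).*2%:R - 0%:R - (i + d)%:R + j%:R)
   = (\prod_(j < d) (i + d + j)%N)%:R :> R.
  rewrite natr_prod; apply: eq_bigr => j _.
  by rewrite -addnn !natrD; ring.
have -> : \prod_(1 <= j < (i + d).+1) ((i + d).*2%:R - j%:R)
   = (\prod_(1 <= j < (i + d).+1) ((i + d).*2 - j)%N)%:R :> R.
  rewrite natr_prod !big_nat; apply: eq_bigr => j j_lt.
  by rewrite natrB //; lia.
have := congr1 (fun k => k%:R : R) (omega_coefE m_gt0).
rewrite /= 3!natrM natrX [in RHS]natrM => coefE.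
transitivity ((2 * z - x) ^+ d * (- z) ^+ i *
  ('C(i + d, i)%:R * (\prod_(j < i) ((i + d).*2 - 1 - 2 * j)%N)%:R *
   (\prod_(j < d) (i + d + j)%N)%:R * 2 ^+ i)); last by rewrite coefE -mulr_natr; ring.
by rewrite -mulr_natr; ring.
Qed.

End OmegaClosedForm.

(** * The Lucas-Lehmer criterion *)

Section LucasLehmer.

Import GRing.Theory.
Local Open Scope ring_scope.

Lemma lucasV_Binet (R : comNzRingType) (x y : R) k :
  lucasV (x + y) (x * y) k = x ^+ k + y ^+ k.
Proof.
suff : lucasV (x + y) (x * y) k = x ^+ k + y ^+ k /\
       lucasV (x + y) (x * y) k.+1 = x ^+ k.+1 + y ^+ k.+1 by case.
elim: k => [|k [IH1 IH2]]; first by rewrite /= !expr0 !expr1.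
by split=> //; rewrite lucasVSS IH1 IH2 !exprS; ring.
Qed.

Lemma lucasV_intr (R : comNzRingType) (P Q : int) k :
  (lucasV P Q k)%:~R = lucasV (P%:~R : R) Q%:~R k.
Proof.
suff : (lucasV P Q k)%:~R = lucasV (P%:~R : R) Q%:~R k /\
       (lucasV P Q k.+1)%:~R = lucasV (P%:~R : R) Q%:~R k.+1 by case.
elim: k => [|k [IH1 IH2]] //.
by split=> //; rewrite !lucasVSS intrB !intrM IH1 IH2.
Qed.

Lemma dvdz_pchar (R : nzRingType) q (m : int) :
  q \in [pchar R] -> (q%:Z %| m)%Z = (m%:~R == 0 :> R).
Proof.
move=> qR; rewrite dvdzE absz_nat (dvdn_pcharf qR).
case: m => n; first by [].
by rewrite NegzE abszN absz_nat rmorphN oppr_eq0.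
Qed.

(** The quotient ring [F_q[X] / (X^2 - 3)], rather than a field generated by a
    square root of 3, has [q ^ 2] elements whether or not 3 is a square modulo
    [q]. *)
Lemma exists_sqrt3_ring q : prime q ->
  exists (A : finComNzRingType) (s : A),
    [/\ s ^+ 2 = 3, q \in [pchar A] & #|A| = (q ^ 2)%N].
Proof.
move=> q_pr; pose h : {poly 'F_q} := 'X^2 - 3%:P.
have size_h : size h = 3%N by rewrite size_XnsubC.
have monic_h : h \is monic by rewrite monicXnsubC.
exists {poly %/ h}, (in_qpoly h 'X); split.
- have h0 : in_qpoly h h = 0.
    by apply: val_inj; rewrite /= /mk_monic size_h monic_h Pdiv.RingMonic.rmodpp.
  transitivity (in_qpoly h (h + 3%:P)); first by rewrite subrK rmorphXn.
  by rewrite in_qpolyD h0 add0r polyC_natr rmorph_nat.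
- by rewrite pchar_qpoly pchar_Fp.
- by rewrite card_monic_qpoly ?size_h // card_Fp.
Qed.

Section Sqrt3.

Variables (R : comNzRingType) (s : R).
Hypothesis s2 : s ^+ 2 = 3.

Let w := - 2 + s.
Let w' := - 2 - s.

Let ww' : w * w' = 1.
Proof. by rewrite /w /w' (_ : _ * _ = 4 - s ^+ 2); [rewrite s2; ring | ring]. Qed.

Lemma lucasV_sqrt3 k :
  ((lucasV (- 4) 1 k : int)%:~R : R) = w ^+ k + w' ^+ k.
Proof.
by rewrite lucasV_intr -lucasV_Binet ww' /w /w'; congr lucasV; rewrite ?rmorphN /=; ring.
Qed.

(** The numbers [w] and [w'] are inverse to each other, so their [k]-th powers are
    opposite exactly when [w ^+ k.*2 = -1]. *)
Lemma lucasV_eq0 k :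
  ((lucasV (- 4) 1 k : int)%:~R == 0 :> R) = (w ^+ k.*2 == -1).
Proof.
rewrite lucasV_sqrt3 -addnn exprD.
have wk : w ^+ k * w' ^+ k = 1 by rewrite -exprMn ww' expr1n.
apply/eqP/eqP => [e | e].
  have {}e : w ^+ k * (w ^+ k + w' ^+ k) = 0 by rewrite e mulr0.
  by apply/eqP; rewrite -addr_eq0 -wk -mulrDr e.
transitivity (w' ^+ k * (w ^+ k * w ^+ k + w ^+ k * w' ^+ k)).
  by rewrite -mulrDr mulrA [w' ^+ k * _]mulrC wk mul1r.
by rewrite e wk addNr mulr0.
Qed.

End Sqrt3.

(** As [-1] is not 1, the order of [w] divides [2 ^ p.+1] and not [2 ^ p], so it
    is [2 ^ p.+1]. *)
Lemma expr_pow2_inj (R : comNzRingType) (w : R) p i j :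
  (2 : R) != 0 -> w ^+ (2 ^ p) = -1 ->
  (i < 2 ^ p.+1)%N -> (j < 2 ^ p.+1)%N -> w ^+ i = w ^+ j -> i = j.
Proof.
move=> R2 wN.
wlog ij : i j / (i <= j)%N.
  move=> H i_lt j_lt e; case: (leqP i j) => ij; [|apply/esym];
    by apply: H => //; exact: ltnW.
move=> _ j_lt e; apply/eqP; rewrite eqn_leq ij -subn_eq0 /= subn_eq0 leqNgt.
apply/negP => ij_lt.
have d_gt0 : (0 < j - i)%N by rewrite subn_gt0.
have [m m_odd d_eq] := pfactor_coprime (isT : prime 2) d_gt0.
rewrite coprime2n in m_odd.
(* As [j - i < 2 ^ p.+1], its 2-part divides [2 ^ p], so [w ^+ (j - i) = 1]
   would give [-1], an odd power of [w ^+ (2 ^ p)], the value 1. *)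
have k_le : (logn 2 (j - i) <= p)%N.
  rewrite -ltnS -(ltn_exp2l _ _ (isT : 1 < 2)%N).
  apply: leq_ltn_trans j_lt; apply: leq_trans (leq_subr i j).
  by rewrite dvdn_leq ?pfactor_dvdnn.
have wd : w ^+ (j - i) = 1.
  have wi : w ^+ (2 ^ p.+1) = 1 by rewrite expnSr exprM wN sqrrN expr1n.
  have : w ^+ (2 ^ p.+1 - i) * w ^+ i = w ^+ (2 ^ p.+1 - i) * w ^+ j by rewrite e.
  have i_lt : (i < 2 ^ p.+1)%N by exact: ltn_trans j_lt.
  rewrite -!exprD subnK ?(ltnW i_lt) // wi.
  have -> : (2 ^ p.+1 - i + j = 2 ^ p.+1 + (j - i))%N by lia.
  by rewrite exprD wi mul1r.
have : (-1 : R) = 1.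
  have <- : w ^+ (2 ^ p * m) = -1 by rewrite exprM wN -signr_odd m_odd expr1.
  rewrite -(subnKC k_le) expnD mulnAC [(_ * m)%N]mulnC -d_eq exprM wd expr1n //.
by move/eqP; rewrite eq_sym -addr_eq0 (negPf R2).
Qed.

(** If [2 ^ p - 1] is composite, it has a prime divisor [q] with [q ^ 2 < 2 ^ p].
    Over such a [q] the element [-2 + s] has order [2 ^ p], more than the number
    of elements of the ring. *)
Lemma lucas_lehmer_sufficient p : (1 < p)%N ->
  ((2 ^ p - 1)%N%:Z %| lucasV (-4) 1 (2 ^ p.-2))%Z -> prime (2 ^ p - 1).
Proof.
move=> p_gt1 M_dvd; apply: contraT.
have pow_gt1 : (2 ^ 2 <= 2 ^ p)%N by rewrite leq_exp2l.
case/primePns => [|[q [q_pr q2_le q_dvd]]]; first by lia.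
have [A [s [s2 qA cardA]]] := exists_sqrt3_ring q_pr.
have q_dvdV : (q%:Z %| lucasV (-4) 1 (2 ^ p.-2))%Z.
  by apply: dvdz_trans M_dvd; rewrite dvdzE.
have A2 : (2 : A) != 0.
  have q_odd : odd q.
    by apply: dvdn_odd q_dvd _; rewrite oddB ?expn_gt0 // oddX; lia.
  rewrite -(dvdn_pcharf qA); apply/negP => /(@dvdn_leq q 2 isT) q_le2.
  by have := prime_gt1 q_pr; lia.
move: q_dvdV; rewrite (dvdz_pchar _ qA) (lucasV_eq0 s2) -mul2n -expnS => /eqP wN.
have inj_w : injective (fun i : 'I_(2 ^ p) => (-2 + s) ^+ i).
  move=> i j e; apply: val_inj; apply: (expr_pow2_inj A2 wN) e;
    by rewrite (_ : p.-2.+2 = p) // ; lia.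
by have := leq_card _ inj_w; rewrite card_ord cardA; lia.
Qed.

(** Euler's criterion for 3 as a non-square.  As 3 divides [q - 1], there is a
    primitive cube root of unity [z] modulo [q], and [-3 = (2 * z + 1) ^+ 2]; as
    [q./2] is odd, [3 ^ q./2] is opposite to [(-3) ^ q./2 = 1]. *)
Lemma three_nonresidue q : prime q -> (q %% 12 = 7)%N ->
  (q %| 3 ^ q./2 + 1)%N.
Proof.
move=> q_pr q12.
have q_char := pchar_Fp q_pr.
rewrite (dvdn_pcharf q_char) natrD natrX.
have q_gt0 := prime_gt0 q_pr.
have nat_neq0 n : (0 < n < q)%N -> n%:R != 0 :> 'F_q.
  by move=> /andP[n0 nq]; rewrite -(dvdn_pcharf q_char); apply/negP => /(dvdn_leq n0); lia.
have fermat (x : 'F_q) : x != 0 -> x ^+ q.-1 = 1.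
  move=> x0; apply: (mulfI x0); rewrite -exprS prednK // mulr1.
  by have := expf_card x; rewrite card_Fp.
pose r := (q %/ 3)%N.
(* Otherwise ['X^r - 1] would have [q.-1 = 3 * r] roots. *)
have [a a0 ar] : exists2 a : 'F_q, a != 0 & a ^+ r != 1.
  apply/exists_inP; apply: contraT; rewrite negb_exists_in => /forall_inP roots.
  have r_gt0 : (0 < r)%N by rewrite /r; lia.
  have := @max_unity_roots 'F_q r (enum (predC1 0)) r_gt0.
  rewrite enum_uniq -cardE cardC1 card_Fp // => /(_ _ isT).
  suff -> : all r.-unity_root (enum (predC1 (0 : 'F_q))).
    by move/(_ isT); rewrite /r; lia.
  apply/allP => x; rewrite mem_enum => x0.
  by rewrite unity_rootE -[_ == _]negbK roots.
pose z := a ^+ r.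
have z3 : z ^+ 3 = 1.
  by rewrite /z -exprM (_ : r * 3 = q.-1)%N ?fermat // /r; lia.
have z_root : z ^+ 2 + z + 1 = 0.
  apply: (@mulfI _ (z - 1)); first by rewrite subr_eq0.
  by rewrite mulr0 -[RHS](subrr 1) -[X in _ = X - _]z3; ring.
pose y := 2 * z + 1.
have y2 : y ^+ 2 = - 3.
  by rewrite -[RHS]addr0 -(mulr0 4) -z_root /y; ring.
have three_neq0 : (3 : 'F_q) != 0 by apply: nat_neq0; lia.
have y0 : y != 0 by apply: contra three_neq0 => /eqP y0; rewrite -oppr_eq0 -y2 y0 expr0n.
have := fermat y y0.
rewrite (_ : q.-1 = 2 * q./2)%N; last by lia.
rewrite exprM y2 -mulN1r exprMn -signr_odd.
have -> : odd q./2 by lia.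
by rewrite expr1 mulN1r => /eqP; rewrite eqr_oppLR addr_eq0.
Qed.

(** The element [u = 1 - s] satisfies [u ^+ 2 = - (2 * w)], where [w = -2 + s].
    As 3 is not a square modulo [q = 2 ^ p - 1], the Frobenius map sends [s] to
    [- s], hence [u ^+ q.+1 = (1 - s) * (1 + s) = -2].  With [N = q.+1 / 2] this
    says [(2 * w) ^+ N = -2], and 2 is a square modulo [q], so [2 ^+ N = 2].
    Cancelling 2 leaves [w ^+ N = -1]. *)
Lemma lucas_lehmer_necessary p : (2 < p)%N -> odd p ->
  prime (2 ^ p - 1) -> ((2 ^ p - 1)%N%:Z %| lucasV (-4) 1 (2 ^ p.-2))%Z.
Proof.
move=> p_gt2 p_odd; set q := (2 ^ p - 1)%N => q_pr.
have pow_gt0 : (0 < 2 ^ p)%N by rewrite expn_gt0.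
have qS : q.+1 = (2 ^ p)%N by rewrite /q; lia.
have q12 : (q %% 12 = 7)%N.
  rewrite /q; have [k ->] : exists k, p = (k.*2 + 3)%N by exists (p./2 - 1)%N; lia.
  suff : (2 ^ (k.*2 + 3) %% 12 = 8)%N by lia.
  by elim: k => // k; rewrite doubleS !addSn !expnS; lia.
have [A [s [s2 qA _]]] := exists_sqrt3_ring q_pr.
rewrite (dvdz_pchar _ qA) (lucasV_eq0 s2) -mul2n -expnS (_ : p.-2.+1 = p.-1); last by lia.
set N := (2 ^ p.-1)%N.
have N2 : (2 * N)%N = q.+1 by rewrite qS /N -expnS prednK //; lia.
have p2A : (2 : A) ^+ p = 1.
  by rewrite -natrX -qS -natr1 pcharf0 ?add0r.
have two_N : (2 : A) ^+ N = 2.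
  (* As [2 ^+ p = 1] and [p] is odd, [2 ^ ((p + 1) / 2)] is a square root of 2,
     and as an integer it is fixed by the Frobenius map. *)
  pose x := (2 ^ p.+1./2)%N.
  have x2 : (x%:R : A) ^+ 2 = 2.
    rewrite /x natrX -exprM (_ : p.+1./2 * 2 = p.+1)%N; last by lia.
    by rewrite exprS p2A mulr1.
  by rewrite -[in LHS]x2 -exprM N2 exprS -(pFrobenius_autE qA) pFrobenius_aut_nat -expr2.
have sq : s ^+ q = - s.
  have -> : q = (2 * q./2).+1%N by lia.
  rewrite exprS exprM s2.
  have /eqP : ((3 ^ q./2 + 1)%N%:R : A) = 0.
    by apply/eqP; rewrite -(dvdn_pcharf qA) three_nonresidue.
  by rewrite natrD natrX addr_eq0 => /eqP->; rewrite mulrN1.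
have uq : (1 - s) ^+ q.+1 = - 2.
  rewrite exprS -(pFrobenius_autE qA) rmorphB rmorph1 /= pFrobenius_autE sq.
  by rewrite (_ : _ * _ = 1 - s ^+ 2); [rewrite s2; ring | ring].
have wN : 2 * (-2 + s) ^+ N = - 2.
  transitivity (2 ^+ N * (-2 + s) ^+ N); first by rewrite two_N.
  rewrite -exprMn -[RHS]uq -N2 exprM.
  have -> : (1 - s) ^+ 2 = - (2 * (-2 + s)).
    by rewrite (_ : _ ^+ 2 = 1 - 2 * s + s ^+ 2); [rewrite s2; ring | ring].
  rewrite [RHS]exprNn -signr_odd (_ : odd N = false) ?mul1r //.
  by rewrite /N (_ : p.-1 = p.-2.+1) ?expnS ?oddM //; lia.
(* Since [2 ^+ p = 1], the element 2 is cancelled by multiplying by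
   [2 ^+ p.-1]. *)
have pS : p.-1.+1 = p by lia.
have := congr1 (fun x => 2 ^+ p.-1 * x) wN.
by rewrite /= mulrA mulrN -exprSr pS p2A mul1r => ->.
Qed.

End LucasLehmer.

(** * The ratio as a Lucas-Lehmer residue *)

Section Ratio.

Import GRing.Theory Num.Theory.
Local Open Scope ring_scope.

Lemma Omega_ratioE m : (0 < m)%N ->
  Omega_ratio m.*2 = (lucasV (-4 : int) 1 m)%:~R.
Proof.
move=> m_gt0; rewrite /Omega_ratio doubleK Omega_half // expr1n intrM.
rewrite rmorph_prod /=.
rewrite (eq_bigr (fun j : nat => m.*2%:R - j%:R)) => [|j _]; last first.
  by rewrite rmorphB !rmorph_nat.
rewrite mulfK // prodf_seq_neq0; apply/allP => j.
rewrite mem_index_iota => j_lt; rewrite subr_eq0 eqr_nat; apply/eqP; lia.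
Qed.

Lemma int_dvd_ratE (d z : int) : int_dvd_rat d z%:~R <-> (d %| z)%Z.
Proof.
by split=> [[t /intr_inj->] | dz]; last exists z.
Qed.

End Ratio.

(** The Lucas-Lehmer test needs [p] odd.  The only even exponent, [p = 2], gives
    [N = 6], where the ratio is [-4] and is not divisible by 3. *)
Theorem theorem54 (N : nat) (hN : N <> 6) :
  (perfect N /\ ~~ odd N) <->
  (exists p : nat,
    [/\ prime p,
        N = 2 ^ p.-1 * (2 ^ p - 1) &
        let n := 2 ^ p.-1 in
        int_dvd_rat (2 * n%:Z - 1)%R (Omega_ratio n)]).
Proof.
have dvdE p : 1 < p ->
    int_dvd_rat (2 * (2 ^ p.-1)%N%:Z - 1)%R (Omega_ratio (2 ^ p.-1)) <->
    ((2 ^ p - 1)%N%:Z %| lucasV (-4)%R 1%R (2 ^ p.-2))%Z.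
  case: p => [|[|p]] //= _.
  have -> : (2 * (2 ^ p.+1)%N%:Z - 1 = (2 ^ p.+2 - 1)%N)%R.
    by have := expn_gt0 2 p.+1; rewrite (expnS 2 p.+1); lia.
  by rewrite (_ : 2 ^ p.+1 = (2 ^ p).*2) ?(expnS 2 p) ?mul2n //
    Omega_ratioE ?expn_gt0 // int_dvd_ratE.
rewrite even_perfectP; split=> [[p [p_gt1 N_eq M_pr]] | [p [p_pr N_eq]]].
  have p_pr := mersenne_prime_exponent M_pr.
  exists p; split=> //; apply/dvdE => //.
  apply: lucas_lehmer_necessary => //.
    by rewrite ltn_neqAle p_gt1 andbT; apply/eqP => p2; apply: hN; rewrite N_eq -p2.
  by case: (even_prime p_pr) => // p2; case: hN; rewrite N_eq p2.
move=> /(dvdE p (prime_gt1 p_pr)) M_dvd.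
by exists p; rewrite (prime_gt1 p_pr) lucas_lehmer_sufficient ?prime_gt1.
Qed.
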